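(* Consider the problem $\min_{x\in\mathbb{R}^n} h(x)+P(\mathcal{M}x)$ and the proximal ADMM with input $(x^0,z^0)$, $\beta$ and $\phi$, as described in the context. Suppose that Assumption A (stated in the context) holds, with constants $\sigma$ and $\gamma$ as there, and that $\beta$ is further chosen so that there exists $\zeta$ with $0<\zeta<2\beta\gamma$ and $$\inf_{x\in\mathbb{R}^n}\left\{h(x)-\frac{1}{\sigma\zeta}\|\nabla h(x)\|^2\right\}>-\infty.$$ Suppose that either (i) $\mathcal{M}$ is invertible and $\liminf_{\|y\|\to\infty}P(y)=\infty$; or (ii) $\liminf_{\|x\|\to\infty}h(x)=\infty$ and $\inf_yP(y)>-\infty$. Then the sequence $\{(x^t,y^t,z^t)\}$ generated from the proximal ADMM is bounded.
   Context: Setting. $\mathcal{M}:\mathbb{R}^n\to\mathbb{R}^m$ is a linear map with adjoint $\mathcal{M}^*$; $h:\mathbb{R}^n\to\mathbb{R}$ is twice continuously differentiable with bounded Hessian; $P:\mathbb{R}^m\to(-\infty,\infty]$ is proper (finite somewhere, never $-\infty$) and closed (lower semicontinuous), possibly nonconvex, and for every $u\in\mathbb{R}^m$ and $\tau>0$ the set of minimizers of $y\mapsto \tau P(y)+\frac12\|y-u\|^2$ is nonempty. $\operatorname{Arg\,min}$ denotes the set of (global) minimizers. Notation. $\mathcal{I}$ is the identity map. For symmetric linear self-maps, $\mathcal{T}_1\succeq\mathcal{T}_2$ (resp. $\succ$) means $\mathcal{T}_1-\mathcal{T}_2$ is positive semidefinite (resp. positive definite). For a continuously differentiable $\phi$,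 the Bregman distance is $D_\phi(x_1,x_2):=\phi(x_1)-\phi(x_2)-\langle\nabla\phi(x_2),x_1-x_2\rangle$. Algorithm (proximal ADMM). For $\beta>0$ let $$L_\beta(x,y,z):=h(x)+P(y)-\langle z,\mathcal{M}x-y\rangle+\frac{\beta}{2}\|\mathcal{M}x-y\|^2.$$ Given input $(x^0,z^0)\in\mathbb{R}^n\times\mathbb{R}^m$, $\beta>0$ and a twice continuously differentiable convex function $\phi:\mathbb{R}^n\to\mathbb{R}$, for $t=0,1,2,\dots$: $$y^{t+1}\in\operatorname{Arg\,min}_y L_\beta(x^t,y,z^t),\quad x^{t+1}\in\operatorname{Arg\,min}_x\{L_\beta(x,y^{t+1},z^t)+D_\phi(x,x^t)\},\quad z^{t+1}=z^t-\beta(\mathcal{M}x^{t+1}-y^{t+1}).$$ Assumption A. (i) $\mathcal{M}\mathcal{M}^*\succeq\sigma\mathcal{I}$ for some $\sigma>0$; and there exist symmetric linear self-maps $\mathcal{Q}_1,\mathcal{Q}_2$ of $\mathbb{R}^n$ such that $\mathcal{Q}_1\succeq\nabla^2h(x)\succeq\mathcal{Q}_2$ for all $x$. (ii) $\beta>0$ and $\phi$ are chosen so that: (a) there exist symmetric $\mathcal{T}_1\succeq\mathcal{T}_2\succeq0$ with $\mathcal{T}_1^2\succeq[\nabla^2\phi(x)]^2\succeq\mathcal{T}_2^2$ for all $x$; (b) $\mathcal{Q}_2+\beta\mathcal{M}^*\mathcal{M}+\mathcal{T}_2\succeq\delta\mathcal{I}$ for some $\delta>0$; (c) with a symmetric $\mathcal{Q}_3$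 satisfying $\mathcal{Q}_3\succeq[\nabla^2h(x)+\nabla^2\phi(x)]^2$ for all $x$, there exists $\gamma\in(0,1)$ such that $\delta\mathcal{I}+\mathcal{T}_2\succ\frac{2}{\sigma\beta}\mathcal{H}_\gamma$, where $\mathcal{H}_\gamma:=\frac1\gamma\mathcal{Q}_3+\frac1{1-\gamma}\mathcal{T}_1^2$. *)

(* Defs.v *)
From HB Require Import structures.
From mathcomp Require Import all_boot all_order all_algebra.
From mathcomp Require Import all_classical all_reals all_analysis.

Set Implicit Arguments.
Unset Strict Implicit.
Unset Printing Implicit Defensive.

Import Order.TTheory GRing.Theory Num.Theory.
Import numFieldNormedType.Exports.

Local Open Scope classical_set_scope.
Local Open Scope ring_scope.

(* R^n is 'cV[R]_n.  Its library topology comes from the sup norm, written with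
   bars; every norm in a formula is the Euclidean norm enorm.  A linear map is
   its matrix, and its adjoint is the transpose. *)

Definition dotv (R : realType) n (u v : 'cV[R]_n) : R := (u^T *m v) 0 0.

Definition enorm (R : realType) n (u : 'cV[R]_n) : R := Num.sqrt (dotv u u).

Definition psdmx (R : realType) n (A : 'M[R]_n) : Prop :=
  forall v : 'cV[R]_n, 0 <= dotv v (A *m v).

Definition pdmx (R : realType) n (A : 'M[R]_n) : Prop :=
  forall v : 'cV[R]_n, v != 0 -> 0 < dotv v (A *m v).

(* Both relations are meant for symmetric matrices; neither includes symmetry. *)
Definition loewner_ge (R : realType) n (A B : 'M[R]_n) : Prop := psdmx (A - B).

Definition loewner_gt (R : realType) n (A B : 'M[R]_n) : Prop := pdmx (A - B).

Definition grad (R : realType) n (f : 'cV[R]_n -> R) (x : 'cV[R]_n) :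
    'cV[R]_n :=
  \col_i 'D_(delta_mx i 0) f x.

Definition hessian (R : realType) n (f : 'cV[R]_n -> R) (x : 'cV[R]_n) :
    'M[R]_n :=
  \matrix_(i, j) 'D_(delta_mx i 0) ('D_(delta_mx j 0) f) x.

Definition twice_cont_differentiable (R : realType) n (f : 'cV[R]_n -> R) :
    Prop :=
  [/\ forall x, differentiable f x,
      forall x, differentiable (grad f) x
    & continuous (hessian f)].

Definition bregman (R : realType) n (phi : 'cV[R]_n -> R)
    (x1 x2 : 'cV[R]_n) : R :=
  phi x1 - phi x2 - dotv (grad phi x2) (x1 - x2).

Definition argmin (R : realType) (T : Type) (f : T -> \bar R) : set T :=
  [set x | forall y, (f x <= f y)%E].

Definition proper_function (R : realType) (T : Type) (f : T -> \bar R) : Prop :=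
  (exists x, (f x < +oo)%E) /\ (forall x, (-oo < f x)%E).

Definition enorm_infty (R : realType) n : set_system 'cV[R]_n :=
  filter_from setT (fun r : R => [set x | r < enorm x]).

Definition aug_lagrangian (R : realType) n m (M : 'M[R]_(m, n))
    (h : 'cV[R]_n -> R) (P : 'cV[R]_m -> \bar R) (beta : R)
    (x : 'cV[R]_n) (y z : 'cV[R]_m) : \bar R :=
  ((h x)%:E + P y - (dotv z (M *m x - y))%:E
   + (beta / 2 * enorm (M *m x - y) ^+ 2)%:E)%E.

(* The iteration only defines y from index 1 on: y 0 is unconstrained. *)
Definition proximal_ADMM (R : realType) n m (M : 'M[R]_(m, n))
    (h : 'cV[R]_n -> R) (P : 'cV[R]_m -> \bar R) (beta : R)
    (phi : 'cV[R]_n -> R) (x0 : 'cV[R]_n) (z0 : 'cV[R]_m)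
    (x : nat -> 'cV[R]_n) (y z : nat -> 'cV[R]_m) : Prop :=
  [/\ x 0%N = x0, z 0%N = z0
    & forall t : nat,
      [/\ argmin (fun v => aug_lagrangian M h P beta (x t) v (z t)) (y t.+1),
          argmin (fun u => (aug_lagrangian M h P beta u (y t.+1) (z t)
                            + (bregman phi u (x t))%:E)%E) (x t.+1)
        & z t.+1 = z t - beta *: (M *m x t.+1 - y t.+1)]].

(* Main.v *)
Require Import Defs.
From HB Require Import structures.
From mathcomp Require Import all_boot all_order all_algebra.
From mathcomp Require Import all_classical all_reals all_analysis.
From mathcomp Require Import ring lra.

Import Order.TTheory GRing.Theory Num.Theory.
Import numFieldNormedType.Exports.

Local Open Scope classical_set_scope.
Local Open Scope ring_scope.

(** The proof is a Lyapunov argument. Along the iteration, the augmented Lagrangian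
    plus a multiple of |T1 (x^t - x^(t-1))|^2 (here [energy]) does not increase
    ([energy_step]): the x-update decreases the Lagrangian by a quadratic amount in
    the step ([proximal_step_decrease]), the multiplier update increases it by
    |z^(t+1) - z^t|^2 / beta, and the optimality condition of the x-update
    ([proximal_step_stationary]) expresses M^T z^(t+1) through gradients of h and
    phi, so that this increase is bounded by the current and the previous step.

    Conversely, the same condition bounds |z^t|^2 by |grad h (x^t)|^2 and the last
    step ([multiplier_le]). Completing the square in the Lagrangian then gives
    ([energy_ge])

      h (x^t) - |grad h (x^t)|^2 / (2 beta sigma gamma) + P (y^t)
        + c |T1 (x^t - x^(t-1))|^2 <= constant,     c > 0.

    The hypothesis on zeta bounds |grad h|^2 by sigma zeta (h - h0), and, as
    zeta < 2 beta gamma, a positive fraction of h survives the subtraction. Hence a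
    lower bound for P (y^t) yields upper bounds for h (x^t), for
    |T1 (x^t - x^(t-1))| and, through [multiplier_le], for z^t. If h is coercive and P is bounded below,
    x^t is bounded, and the multiplier update bounds y^t. If P is coercive, h being
    bounded below bounds P (y^t) above, so y^t is bounded; P is bounded below on
    bounded sets because it has a quadratic minorant ([prox_quadratic_minorant]),
    and x^t is recovered from M x^t by invertibility.

    The calculus rests on the mean value theorem along segments ([mvt_line] and
    [mvt_grad]). It supplies the symmetry of the Hessian ([hessian_sym]), the
    comparison of gradients ([grad_lipschitz]) and the second-order lower bound
    ([second_order_lower_bound]). The hypothesis on phi compares the square
    of its Hessian with that of T2; the comparison without squares follows from convexity
    ([convex_hessian_psd]) and operator monotonicity of the square root
    ([loewner_ge_sqr]). *)

(** * The Euclidean inner product *)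

Section EuclideanSpace.
Context {R : realType}.

Section Dot.
Context {n : nat}.
Implicit Types (u v w : 'cV[R]_n) (A B : 'M[R]_n) (a : R).

Lemma dotvE u v : dotv u v = \sum_i u i 0 * v i 0.
Proof. by rewrite /dotv mxE; apply: eq_bigr => i _; rewrite mxE. Qed.

Lemma dotvC u v : dotv u v = dotv v u.
Proof. by rewrite !dotvE; apply: eq_bigr => i _; rewrite mulrC. Qed.

Lemma dotvDr u v w : dotv u (v + w) = dotv u v + dotv u w.
Proof. by rewrite /dotv mulmxDr mxE. Qed.

Lemma dotvDl u v w : dotv (u + v) w = dotv u w + dotv v w.
Proof. by rewrite ![dotv _ w]dotvC dotvDr. Qed.

Lemma dotvZr a u v : dotv u (a *: v) = a * dotv u v.
Proof. by rewrite /dotv -scalemxAr mxE. Qed.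

Lemma dotvZl a u v : dotv (a *: u) v = a * dotv u v.
Proof. by rewrite dotvC dotvZr dotvC. Qed.

Lemma dotvNr u v : dotv u (- v) = - dotv u v.
Proof. by rewrite -scaleN1r dotvZr mulN1r. Qed.

Lemma dotvNl u v : dotv (- u) v = - dotv u v.
Proof. by rewrite dotvC dotvNr dotvC. Qed.

Lemma dotvBr u v w : dotv u (v - w) = dotv u v - dotv u w.
Proof. by rewrite dotvDr dotvNr. Qed.

Lemma dotv0 u : dotv u 0 = 0.
Proof. by rewrite /dotv mulmx0 mxE. Qed.

Lemma dotv_delta i u : dotv (delta_mx i 0) u = u i 0.
Proof.
rewrite dotvE (bigD1 i)//= mxE !eqxx mul1r big1 ?addr0// => j ji.
by rewrite mxE (negbTE ji) mul0r.
Qed.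

Lemma dotv_ge0 u : 0 <= dotv u u.
Proof. by rewrite dotvE sumr_ge0// => i _; rewrite -expr2 sqr_ge0. Qed.

Lemma dotv_eq0 u : dotv u u = 0 -> u = 0.
Proof.
rewrite dotvE => /eqP; rewrite psumr_eq0; last first.
  by move=> i _; rewrite -expr2 sqr_ge0.
move=> /allP u0; apply/colP => i; rewrite mxE.
by have /implyP/(_ isT) := u0 i (mem_index_enum _); rewrite mulf_eq0 orbb => /eqP.
Qed.

Lemma dotv_gt0 u : u != 0 -> 0 < dotv u u.
Proof.
by move=> u0; rewrite lt_neqAle dotv_ge0 andbT eq_sym; apply: contraNN u0 =>
  /eqP/dotv_eq0 ->.
Qed.

Lemma enorm_sqr u : enorm u ^+ 2 = dotv u u.
Proof. by rewrite /enorm sqr_sqrtr// dotv_ge0. Qed.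

Lemma loewner_ge_dotv A B v :
  loewner_ge A B -> dotv v (B *m v) <= dotv v (A *m v).
Proof. by move/(_ v); rewrite mulmxBl dotvBr subr_ge0. Qed.

End Dot.

Lemma dotv_mulmx {m n} (A : 'M[R]_(m, n)) (u : 'cV_m) (v : 'cV_n) :
  dotv u (A *m v) = dotv (A^T *m u) v.
Proof. by rewrite /dotv trmx_mul trmxK mulmxA. Qed.

(** Nonnegativity of a quadratic in [s] forces a nonpositive discriminant; this
    is the form consumed by Cauchy-Schwarz, degenerate forms included. *)
Lemma quadratic_discriminant (a b c : R) :
  (forall s, 0 <= a + 2 * s * b + s ^+ 2 * c) -> b ^+ 2 <= a * c.
Proof.
move=> q_ge0; pose p := Poly [:: a; 2 * b; c].
have p_ge0 s : 0 <= p.[s].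
  rewrite horner_Poly/=; have := q_ge0 s; congr (_ <= _); ring.
have := deg_le2_poly_ge0 (size_Poly [:: a; 2 * b; c] : (size p <= 3)%N) p_ge0.
rewrite !coef_Poly/=; lra.
Qed.

(** Stated for a merely semidefinite form: it yields the usual inequality with the
    identity, and [psdmx_dotv_eq0] with a degenerate [A]. *)
Lemma psdmx_cauchy_schwarz {n} (A : 'M[R]_n) (u v : 'cV_n) :
  A^T = A -> psdmx A ->
  dotv u (A *m v) ^+ 2 <= dotv u (A *m u) * dotv v (A *m v).
Proof.
move=> Asym A_ge0; apply: quadratic_discriminant => s.
have := A_ge0 (u + s *: v).
rewrite mulmxDr -scalemxAr !(dotvDl, dotvDr, dotvZl, dotvZr).
rewrite [dotv v (A *m u)]dotv_mulmx Asym [dotv (A *m v) u]dotvC => A_uv.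
by apply: le_trans A_uv _; rewrite le_eqVlt; apply/orP; left; apply/eqP; ring.
Qed.

(** Isotropic vectors of a semidefinite form are in its kernel, by Cauchy-Schwarz
    against [A *m v]. *)
Lemma psdmx_dotv_eq0 {n} (A : 'M[R]_n) (v : 'cV_n) :
  A^T = A -> psdmx A -> dotv v (A *m v) = 0 -> A *m v = 0.
Proof.
move=> Asym A_ge0 Av0; apply: dotv_eq0; apply/eqP.
have := psdmx_cauchy_schwarz A (A *m v) v Asym A_ge0.
rewrite Av0 mulr0 => le0.
by rewrite -sqrf_eq0 eq_le le0 sqr_ge0.
Qed.

Lemma cauchy_schwarz {n} (u v : 'cV[R]_n) :
  dotv u v ^+ 2 <= dotv u u * dotv v v.
Proof.
have := @psdmx_cauchy_schwarz n 1%:M u v (trmx1 _ _).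
by rewrite !mul1mx; apply => w; rewrite mul1mx dotv_ge0.
Qed.

Lemma dotv_sqr_entry {n} (u : 'cV[R]_n) i : u i 0 ^+ 2 <= dotv u u.
Proof.
rewrite dotvE (bigD1 i)//= -expr2 lerDl sumr_ge0// => j _.
by rewrite -expr2 sqr_ge0.
Qed.

(** * Symmetric matrices and the Loewner order *)

Lemma continuous_quadratic_form {n} (A : 'M[R]_n) :
  continuous (fun w : 'rV[R]_n => dotv w^T (A *m w^T)).
Proof.
have -> : (fun w : 'rV[R]_n => dotv w^T (A *m w^T)) =
    fun w => \sum_i w 0 i * \sum_j A i j * w 0 j.
  apply/funext => w; rewrite dotvE; apply: eq_bigr => i _; rewrite !mxE.
  by congr (_ * _); apply: eq_bigr => j _; rewrite mxE.
apply: continuous_big => [|i _]; first exact: add_continuous.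
have cM (g : 'rV[R]_n -> R) k : continuous g ->
    continuous (fun w : 'rV[R]_n => w 0 k * g w).
  by move=> gc w; apply: continuousM; [exact: coord_continuous|exact: gc].
apply: (cM (fun w => \sum_j A i j * w 0 j)).
apply: continuous_big => [|j _]; first exact: add_continuous.
under eq_fun do rewrite mulrC.
by apply: (cM (cst (A i j))); exact: cst_continuous.
Qed.

Lemma sphere_compact {n} : compact [set w : 'rV[R]_n | dotv w^T w^T = 1].
Proof.
apply: bounded_closed_compact.
  exists 1; split => // K K_gt1 w /= w1.
  rewrite [leLHS]/Num.norm/= mx_normrE; apply/bigmax_leP; split => /=.
    by rewrite (le_trans ler01)// ltW.
  move=> [i j] _ /=; rewrite (le_trans _ (ltW K_gt1))//.
  rewrite -[leRHS]normr1 -ler_sqr ?nnegrE// !real_normK ?num_real//.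
  rewrite expr1n -w1.
  by have := dotv_sqr_entry w^T j; rewrite mxE [i]ord1.
apply: (@preimage_closed _ _ (fun w : 'rV[R]_n => dotv w^T w^T) [set 1]).
  move=> w _; have := @continuous_quadratic_form n 1%:M w.
  by rewrite /continuous_at; under eq_fun do rewrite mul1mx; rewrite mul1mx.
exact: closed_eq.
Qed.

(** Compactness of the sphere gives a minimizer [w] of the Rayleigh quotient.
    With [mu] the minimal value, [C - mu] is semidefinite and isotropic at [w], so
    [w] is in its kernel. *)
Lemma symmx_min_eigenvector {n} (C : 'M[R]_n.+1) : C^T = C ->
  exists mu (w : 'cV[R]_n.+1), [/\ w != 0, C *m w = mu *: w &
    forall v, mu * dotv v v <= dotv v (C *m v)].
Proof.
move=> Csym.
have sphere0 : [set w : 'rV[R]_n.+1 | dotv w^T w^T = 1] !=set0.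
  exists (delta_mx ord0 ord0) => /=.
  by rewrite trmx_delta dotv_delta mxE !eqxx.
have [w /[!inE]/= w1 w_min] := EVT_min_rV sphere0 sphere_compact
    (continuous_subspaceT (continuous_quadratic_form C)).
set mu := dotv w^T (C *m w^T) in w_min.
have mu_le v : mu * dotv v v <= dotv v (C *m v).
  have [->|v0] := eqVneq v 0; first by rewrite mulmx0 !dotv0 mulr0.
  have v_gt0 := dotv_gt0 _ v0.
  have sqK : Num.sqrt (dotv v v) ^+ 2 = dotv v v by rewrite sqr_sqrtr// ltW.
  have s0 : Num.sqrt (dotv v v) != 0 by rewrite gt_eqF// sqrtr_gt0.
  have := w_min ((Num.sqrt (dotv v v))^-1 *: v)^T.
  rewrite inE/= !trmxK -scalemxAr !(dotvZl, dotvZr).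
  rewrite mulrA -expr2 exprVn sqK mulVf ?gt_eqF// => /(_ erefl).
  by rewrite mulrA -expr2 exprVn sqK mulrC ler_pdivlMr.
exists mu, w^T; split => //.
  by apply: contra_eqN w1 => /eqP ->; rewrite dotv0 eq_sym oner_eq0.
apply/eqP; rewrite -subr_eq0; apply/eqP.
rewrite -mul_scalar_mx -mulmxBl; apply: psdmx_dotv_eq0.
- by rewrite linearB/= Csym tr_scalar_mx.
- by move=> v; rewrite mulmxBl mul_scalar_mx dotvBr dotvZr subr_ge0.
- by rewrite mulmxBl mul_scalar_mx dotvBr dotvZr w1 mulr1 subrr.
Qed.

(** The square root is operator monotone. Let [w] be an eigenvector of [A - B]
    for its least eigenvalue [mu]. From [A w = B w + mu w],
    |A w|^2 - |B w|^2 = mu (<w, A w> + <w, B w>), while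
    <w, A w> - <w, B w> = mu |w|^2; a negative [mu] makes the first quantity
    negative, since the second forces <w, B w> > 0. *)
Lemma loewner_ge_sqr {n} (A B : 'M[R]_n) :
  A^T = A -> B^T = B -> psdmx A -> psdmx B ->
  loewner_ge (A *m A) (B *m B) -> loewner_ge A B.
Proof.
case: n A B => [|n] A B Asym Bsym A_ge0 B_ge0 AABB.
  by move=> v; rewrite [v]flatmx0 mulmx0 dotv0.
have Csym : (A - B)^T = A - B by rewrite linearB/= Asym Bsym.
have [mu [w [w0 Cw mu_min]]] := symmx_min_eigenvector _ Csym.
have [mu_ge0|mu_lt0] := leP 0 mu.
  by move=> v; rewrite (le_trans _ (mu_min v))// mulr_ge0// dotv_ge0.
have w_gt0 := dotv_gt0 _ w0.
(* Everything below is linear arithmetic in <w, Bw>, <w, w> and |Bw|^2 once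
   A w is eliminated. *)
have Aw : A *m w = B *m w + mu *: w by rewrite -Cw mulmxBl addrC subrK.
have := loewner_ge_dotv _ _ w AABB.
rewrite -!mulmxA !(dotv_mulmx _ w) Asym Bsym Aw.
have := A_ge0 w; rewrite Aw.
rewrite !(dotvDl, dotvDr, dotvZl, dotvZr) (dotvC (B *m w) w).
set b := dotv w (B *m w); set q := dotv w w; set bb := dotv (B *m w) _.
move=> a_ge0 le_bb.
have muq : mu * q < 0 by rewrite nmulr_rlt0.
have : mu * (b + (b + mu * q)) < 0 by rewrite nmulr_rlt0//; lra.
move: le_bb; rewrite mulrDr; lra.
Qed.

End EuclideanSpace.

(** * Gradients, Hessians and the mean value theorem *)

Section Calculus.
Context {R : realType} {n : nat}.
Implicit Types (f g : 'cV[R]_n -> R) (x d u v : 'cV[R]_n).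

(** The difference quotients of both sides are literally the same function. *)
Lemma is_derive_line f x d (s df : R) :
  is_derive (x + s *: d) d f df ->
  is_derive s 1 (fun t : R => f (x + t *: d)) df.
Proof.
have quotE : (fun h : R => h^-1 *: (((fun t : R => f (x + t *: d)) \o shift s)
      (h *: 1) - f (x + s *: d))) =
    (fun h => h^-1 *: ((f \o shift (x + s *: d)) (h *: d) - f (x + s *: d))).
  apply/funext => h /=; congr (_ *: (f _ - _)).
  by rewrite [h *: 1]mulr1 scalerDl addrCA.
by case=> fd fdE; split; [rewrite /derivable quotE|rewrite /derive quotE].
Qed.

Lemma derive_grad f x d : differentiable f x -> 'D_d f x = dotv (grad f x) d.
Proof.
move=> fx; rewrite deriveE// [in LHS](matrix_sum_delta d) dotvE.
rewrite linear_sum/=; apply: eq_bigr => i _.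
by rewrite big_ord1 linearZ/= mxE deriveE// mulrC.
Qed.

Lemma is_derive_grad_line f x d (s : R) : differentiable f (x + s *: d) ->
  is_derive s 1 (fun t : R => f (x + t *: d)) (dotv (grad f (x + s *: d)) d).
Proof.
move=> fx; apply: is_derive_line; split; first exact: diff_derivable.
exact: derive_grad.
Qed.

Lemma mvt_line f x d : (forall y, differentiable f y) ->
  exists2 c : R, 0 < c < 1 & f (x + d) - f x = dotv (grad f (x + c *: d)) d.
Proof.
move=> fdiff.
have fd (s : R) := is_derive_grad_line f x d s (fdiff _).
have [|c c01] := @MVT R (fun s => f (x + s *: d)) _ 0 1 ltr01 (fun s _ => fd s).
  apply: continuous_subspaceT => s; apply: differentiable_continuous.
  by apply/derivable1_diffP; have [] := fd s.
rewrite scale1r scale0r addr0 subr0 mulr1 => ->; exists c => //.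
Qed.

Lemma differentiable_partial f j x : differentiable (grad f) x ->
  differentiable ('D_(delta_mx j 0) f) x.
Proof.
move=> gx; rewrite (_ : 'D_ _ _ = (fun N : 'cV[R]_n => N j 0) \o grad f).
  by apply: differentiable_comp => //; exact: differentiable_coord.
by apply/funext => y /=; rewrite mxE.
Qed.

Lemma dotv_gradE f v : (fun y => dotv v (grad f y)) =
  \sum_j (v j 0 *: 'D_(delta_mx j 0) f).
Proof.
apply/funext => y; rewrite dotvE fct_sumE.
by apply: eq_bigr => j _; rewrite mxE.
Qed.

Lemma dotv_grad_differentiable f v x : differentiable (grad f) x ->
  differentiable (fun y => dotv v (grad f y)) x.
Proof.
move=> gx; rewrite dotv_gradE; apply: differentiable_sum => j.
by apply: differentiableZ; exact: differentiable_partial.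
Qed.

(** This reduces facts on the vector field [grad f] to facts on scalar functions:
    the mean value theorem applied to [fun y => dotv v (grad f y)] replaces the
    integral formula for a difference of gradients. *)
Lemma grad_dotv_grad f v x : differentiable (grad f) x ->
  grad (fun y => dotv v (grad f y)) x = hessian f x *m v.
Proof.
move=> gx; apply/colP => i; rewrite mxE dotv_gradE.
have Dj j : derivable ('D_(delta_mx j 0) f) x (delta_mx i 0).
  by apply: diff_derivable; exact: differentiable_partial.
rewrite derive_sum; last by move=> j; apply: derivableZ.
by rewrite mxE; apply: eq_bigr => j _; rewrite deriveZ// mxE [RHS]mulrC.
Qed.

Lemma mvt_grad f v x d : twice_cont_differentiable f ->
  exists2 c : R, 0 < c < 1 &
    dotv v (grad f (x + d) - grad f x) = dotv (hessian f (x + c *: d) *m v) d.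
Proof.
move=> [_ gdiff _].
have [c c01 fE] := mvt_line (fun y => dotv v (grad f y)) x d
  (fun y => dotv_grad_differentiable f v y (gdiff y)).
by exists c => //; rewrite dotvBr fE grad_dotv_grad.
Qed.

(** Passage to the limit: the evaluation points may differ on the two sides, as
    happens when they come from two uses of the mean value theorem. *)
Lemma le_of_nearby_le (g1 g2 : 'cV[R]_n -> R) x (K : R) :
  0 <= K -> {for x, continuous g1} -> {for x, continuous g2} ->
  (forall s : R, 0 < s < 1 -> exists w1 w2,
    [/\ `|w1| <= s * K, `|w2| <= s * K & g1 (x + w1) <= g2 (x + w2)]) ->
  g1 x <= g2 x.
Proof.
move=> K_ge0 g1x g2x near_le; apply/ler_addgt0Pr => /= e e_gt0.
have e2_gt0 : 0 < e / 2 by rewrite divr_gt0.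
move/cvgrPdist_lt/(_ _ e2_gt0)/nbhs_normP: g1x => [r1 /= r1_gt0 ball_r1].
move/cvgrPdist_lt/(_ _ e2_gt0)/nbhs_normP: g2x => [r2 /= r2_gt0 ball_r2].
pose s := Num.min 2^-1 (Num.min r1 r2 / (2 * (K + 1))).
have K1 : 0 < 2 * (K + 1) by rewrite mulr_gt0// ltr_wpDl.
have s_gt0 : 0 < s by rewrite lt_min invr_gt0 ltr0n divr_gt0// lt_min r1_gt0.
have s_lt1 : s < 1 by rewrite gt_min; apply/orP; left; lra.
have [|w1 [w2 [w1_le w2_le g12]]] := near_le s; first by rewrite s_gt0.
have /andP[sr1 sr2] : (s * (2 * (K + 1)) <= r1) && (s * (2 * (K + 1)) <= r2).
  by rewrite -le_min -ler_pdivlMr// ge_min lexx orbT.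
clearbody s.
have [sK1 sK2] : s * K < r1 /\ s * K < r2 by split; lra.
have sK_ge0 : 0 <= s * K by rewrite mulr_ge0// ltW.
have /ball_r1/= : ball_ Num.norm x r1 (x + w1).
  by rewrite /ball_/= opprD addNKr normrN (le_lt_trans w1_le).
have /ball_r2/= : ball_ Num.norm x r2 (x + w2).
  by rewrite /ball_/= opprD addNKr normrN (le_lt_trans w2_le).
by rewrite !ltr_norml => /andP[? _] /andP[_ ?]; lra.
Qed.

(** Two applications of the mean value theorem, first along [u], then along [v].
    The left-hand side is symmetric in [u] and [v], which gives
    [hessian_sym]. *)
Lemma second_difference f x u v : twice_cont_differentiable f ->
  exists c c' : R, [/\ 0 < c < 1, 0 < c' < 1 &
    f (x + u + v) - f (x + u) - (f (x + v) - f x) =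
    dotv (hessian f (x + c *: u + c' *: v) *m u) v].
Proof.
move=> fC2; have [fdiff gdiff _] := fC2.
have gridiff y : differentiable (fun z => f (z + v) - f z) y.
  apply: differentiableB => //.
  apply: (@differentiable_comp _ _ _ _ (fun z : 'cV[R]_n => z + v) f) => //.
have [c c01 fE] := mvt_line (fun z => f (z + v) - f z) x u gridiff.
have gradE y : grad (fun z => f (z + v) - f z) y = grad f (y + v) - grad f y.
  apply/colP => i; rewrite !mxE deriveB; first 1 last.
  - by apply: diff_derivable; exact: (differentiable_comp _ (fdiff _)).
  - exact: diff_derivable.
  congr (_ - _); rewrite /derive.
  by under eq_fun do rewrite /= -addrA.
have [c' c'01 gE] := mvt_grad f u (x + c *: u) v fC2.
exists c, c'; split => //.
by rewrite opprB addrA addrAC -gE dotvC -gradE -fE; ring.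
Qed.

Lemma hessian_form_continuous f u v : twice_cont_differentiable f ->
  continuous (fun y => dotv (hessian f y *m u) v).
Proof.
move=> [_ _ Hc].
have cM (g : 'cV[R]_n -> R) (k : R) : continuous g ->
    continuous (fun y => g y * k).
  by move=> gc y; apply: continuousM; [exact: gc|exact: cst_continuous].
have -> : (fun y => dotv (hessian f y *m u) v) =
    fun y => \sum_i (\sum_j hessian f y i j * u j 0) * v i 0.
  by apply/funext => y; rewrite dotvE; apply: eq_bigr => i _; rewrite mxE.
apply: continuous_big => [|i _]; first exact: add_continuous.
apply: (cM (fun y => \sum_j hessian f y i j * u j 0)).
apply: continuous_big => [|j _]; first exact: add_continuous.
apply: (cM (fun y => hessian f y i j)) => y.
apply: (@continuous_comp _ _ _ (hessian f) (fun N : 'M[R]_n => N i j)).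
  exact: Hc.
exact: coord_continuous.
Qed.

(** Equality of mixed partial derivatives: the second difference along small
    multiples of [u] and [v] is computed in both orders, and continuity of the
    Hessian lets the intermediate points tend to [x]. *)
Lemma hessian_sym f x : twice_cont_differentiable f ->
  (hessian f x)^T = hessian f x.
Proof.
move=> fC2.
have form_le u v : dotv (hessian f x *m u) v <= dotv (hessian f x *m v) u.
  apply: (@le_of_nearby_le (fun y => dotv (hessian f y *m u) v)
    (fun y => dotv (hessian f y *m v) u) x (`|u| + `|v|)).
  - exact: addr_ge0.
  - exact: hessian_form_continuous.
  - exact: hessian_form_continuous.
  move=> s /andP[s_gt0 s_lt1].
  have [a [a' [a01 a'01 aE]]] := second_difference f x (s *: u) (s *: v) fC2.
  have [b [b' [b01 b'01 bE]]] := second_difference f x (s *: v) (s *: u) fC2.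
  have w_le (k k' : R) (y z : 'cV[R]_n) : 0 < k < 1 -> 0 < k' < 1 ->
      `|k *: (s *: y) + k' *: (s *: z)| <= s * (`|y| + `|z|).
    move=> /andP[k0 k1] /andP[k'0 k'1]; rewrite (le_trans (ler_normD _ _))//.
    rewrite mulrDr !normrZ (gtr0_norm k0) (gtr0_norm k'0) (gtr0_norm s_gt0).
    by rewrite lerD// ler_piMl ?mulr_ge0// ltW.
  exists (a *: (s *: u) + a' *: (s *: v)), (b *: (s *: v) + b' *: (s *: u)).
  split; [exact: w_le|by rewrite [`|u| + _]addrC; exact: w_le|].
  rewrite -scalemxAr dotvZl dotvZr in aE; rewrite -scalemxAr dotvZl dotvZr in bE.
  rewrite !(addrA x).
  rewrite -(ler_pM2l s_gt0) -(ler_pM2l s_gt0) -aE -bE [x + s *: v + s *: u]addrAC.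
  rewrite le_eqVlt; apply/orP; left; apply/eqP. ring.
have form_sym u v : dotv (hessian f x *m u) v = dotv (hessian f x *m v) u.
  by apply/eqP; rewrite eq_le !form_le.
apply/matrixP => i j; rewrite mxE.
have HE (k l : 'I_n) : hessian f x k l =
    dotv (hessian f x *m delta_mx l 0) (delta_mx k 0).
  by rewrite dotvC dotv_delta -colE [RHS]mxE.
by rewrite !HE form_sym.
Qed.

(** By convexity the slopes (f (x + s d) - f x) / s are at most f (x + d) - f x,
    and they tend to the directional derivative. *)
Lemma convex_grad_le f x d : twice_cont_differentiable f ->
  convex_function setT f -> dotv (grad f x) d <= f (x + d) - f x.
Proof.
move=> [fdiff gdiff _] fconvex.
have gradC : continuous (fun y => dotv (grad f y) d).
  have -> : (fun y => dotv (grad f y) d) = fun y => dotv d (grad f y).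
    by apply/funext => y; rewrite dotvC.
  move=> y; apply: differentiable_continuous.
  exact: dotv_grad_differentiable.
apply: (@le_of_nearby_le (fun y => dotv (grad f y) d)
  (cst (f (x + d) - f x)) x `|d|); [exact: normr_ge0|exact: gradC|exact: cst_continuous|].
move=> s /andP[s_gt0 s_lt1].
have [c /andP[c_gt0 c_lt1] fE] := mvt_line f x (s *: d) fdiff.
exists (c *: (s *: d)), 0; split.
- rewrite !normrZ (gtr0_norm c_gt0) (gtr0_norm s_gt0).
  by rewrite ler_piMl ?mulr_ge0// ltW.
- by rewrite normr0 mulr_ge0// ltW.
rewrite -(ler_pM2l s_gt0) -dotvZr -fE /cst.
have := fconvex (Itv01 (ltW s_gt0) (ltW s_lt1)) (x + d) x.
rewrite !inE => /(_ I I) fs.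
have : f (s *: (x + d) + (1 - s) *: x) <= s * f (x + d) + (1 - s) * f x := fs.
have -> : s *: (x + d) + (1 - s) *: x = x + s *: d.
  by rewrite scalerBl scale1r scalerDr [LHS]addrC addrA subrK.
lra.
Qed.

(** The gradient of a convex function is monotone: add the tangent inequalities at
    [x] and [x + s v]. The mean value theorem turns monotonicity into
    nonnegativity of the Hessian form at nearby points. *)
Lemma convex_hessian_psd f x : twice_cont_differentiable f ->
  convex_function setT f -> psdmx (hessian f x).
Proof.
move=> fC2 fconvex v; rewrite dotvC.
apply: (@le_of_nearby_le (cst 0) (fun y => dotv (hessian f y *m v) v) x `|v|).
- exact: normr_ge0.
- exact: cst_continuous.
- exact: hessian_form_continuous.
move=> s /andP[s_gt0 s_lt1].
have [c /andP[c_gt0 c_lt1] gE] := mvt_grad f (s *: v) x (s *: v) fC2.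
exists 0, (c *: (s *: v)); split.
- by rewrite normr0 mulr_ge0// ltW.
- rewrite !normrZ (gtr0_norm c_gt0) (gtr0_norm s_gt0).
  by rewrite ler_piMl ?mulr_ge0// ltW.
rewrite /cst -(pmulr_rge0 _ s_gt0) -(pmulr_rge0 _ s_gt0).
rewrite -dotvZl -dotvZr scalemxAr -gE dotvBr.
have := convex_grad_le f x (s *: v) fC2 fconvex.
have := convex_grad_le f (x + s *: v) (- (s *: v)) fC2 fconvex.
rewrite addrK dotvNr ![dotv (s *: v) _]dotvC; lra.
Qed.

(** With [v] the difference of gradients, the mean value theorem gives
    |v|^2 = <v, H d> for some Hessian [H] on the segment, so |v| <= |H d| by
    Cauchy-Schwarz, and |H d|^2 = <d, H^2 d> because [H] is symmetric. *)
Lemma grad_lipschitz f (Q : 'M[R]_n) x d : twice_cont_differentiable f ->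
  (forall y, loewner_ge Q (hessian f y *m hessian f y)) ->
  dotv (grad f (x + d) - grad f x) (grad f (x + d) - grad f x) <=
  dotv d (Q *m d).
Proof.
move=> fC2 Q_ge; set v := grad f (x + d) - grad f x.
have [c _] := mvt_grad f v x d fC2; rewrite -/v => vvE.
have H_le : dotv (hessian f (x + c *: d) *m d) (hessian f (x + c *: d) *m d)
    <= dotv d (Q *m d).
  have := loewner_ge_dotv _ _ d (Q_ge (x + c *: d)).
  by rewrite -mulmxA dotv_mulmx hessian_sym.
apply: le_trans H_le.
have := cauchy_schwarz v (hessian f (x + c *: d) *m d).
rewrite [dotv v (_ *m d)]dotv_mulmx hessian_sym// -vvE expr2.
have [->|v0] := eqVneq v 0; first by rewrite dotv0 dotv_ge0.
by rewrite ler_pM2l// dotv_gt0.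
Qed.

Lemma is_derive_line_quadratic f x d (b c s : R) :
  (forall y, differentiable f y) ->
  is_derive s 1 (fun t : R => f (x + t *: d) + (t * b + t ^+ 2 * c))
    (dotv (grad f (x + s *: d)) d + (b + 2 * s * c)).
Proof.
move=> fdiff; have fd := is_derive_grad_line f x d s (fdiff _).
pose p : {poly R} := b *: 'X + c *: 'X^2.
have pE t : p.[t] = t * b + t ^+ 2 * c.
  by rewrite hornerD !hornerZ hornerXn hornerX ![_ * b]mulrC ![_ * c]mulrC.
have p'E : p^`().[s] = b + 2 * s * c.
  rewrite derivD !derivZ derivX derivXn hornerD !hornerZ hornerMn hornerXn hornerC.
  by rewrite -mulr_natl expr1; ring.
have -> : (fun t : R => f (x + t *: d) + (t * b + t ^+ 2 * c)) =
    (fun t : R => f (x + t *: d)) + horner p.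
  by apply/funext => t; rewrite fctE pE.
by rewrite -p'E; apply: is_deriveD.
Qed.

(** The function s |-> f (x + s d) - s <grad f x, d> - s^2/2 <d, Q d> has a
    nonnegative derivative on [0, 1]. *)
Lemma second_order_lower_bound f (Q : 'M[R]_n) x d :
  twice_cont_differentiable f ->
  (forall y, loewner_ge (hessian f y) Q) ->
  f x + dotv (grad f x) d + 2^-1 * dotv d (Q *m d) <= f (x + d).
Proof.
move=> fC2 H_ge; have [fdiff gdiff _] := fC2.
set b := dotv (grad f x) d; set q := dotv d (Q *m d).
have Fd (s : R) := is_derive_line_quadratic f x d (- b) (- (2^-1 * q)) s fdiff.
have [|c /[!in_itv]/= /andP[c_gt0 _]] := @MVT R _ _ 0 1 ltr01 (fun s _ => Fd s).
  apply: continuous_subspaceT => s; apply: differentiable_continuous.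
  by apply/derivable1_diffP; have [] := Fd s.
rewrite scale1r scale0r addr0 subr0 mulr1.
have [c' _] := mvt_grad f d x (c *: d) fC2.
rewrite dotvBr dotvZr ![dotv d (grad _ _)]dotvC -/b => gE.
have := loewner_ge_dotv _ _ d (H_ge (x + c' *: (c *: d))).
rewrite -/q [dotv d (hessian _ _ *m d)]dotvC -(ler_pM2l c_gt0) -gE; lra.
Qed.

(** First-order condition for [f] plus a quadratic function. Only the values of
    the quadratic along the line enter, through the coefficients [b] and [c]. *)
Lemma stationary_of_min f x d (b c : R) : (forall y, differentiable f y) ->
  (forall s : R, f x <= f (x + s *: d) + (s * b + s ^+ 2 * c)) ->
  dotv (grad f x) d + b = 0.
Proof.
move=> fdiff f_min.
have Fd (s : R) := is_derive_line_quadratic f x d b c s fdiff.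
have [_ FE] := Fd 0.
have [_ ] : is_derive (0 : R) 1
    (fun t : R => f (x + t *: d) + (t * b + t ^+ 2 * c)) 0.
  apply: (@derive1_at_min R _ (-1) 1); first by rewrite (le_trans (lerN10 _)) ?ler01.
  - by move=> t _; have [] := Fd t.
  - by rewrite in_itv/= ltrN10 ltr01.
  move=> t _; rewrite scale0r addr0 mul0r expr0n/= mul0r !addr0.
  exact: f_min.
by rewrite FE scale0r addr0 mulr0 mul0r addr0.
Qed.

Lemma gradD f g x : differentiable f x -> differentiable g x ->
  grad (fun y => f y + g y) x = grad f x + grad g x.
Proof.
move=> fx gx; apply/colP => i; rewrite !mxE.
by apply: deriveD; exact: diff_derivable.
Qed.

Lemma hessianD f g x : twice_cont_differentiable f ->
  twice_cont_differentiable g ->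
  hessian (fun y => f y + g y) x = hessian f x + hessian g x.
Proof.
move=> [fd fgd _] [gd ggd _]; apply/matrixP => i j.
rewrite mxE [RHS]mxE.
have -> : 'D_(delta_mx j 0) (fun y => f y + g y) =
    'D_(delta_mx j 0) f + 'D_(delta_mx j 0) g.
  by apply/funext => y; apply: deriveD; exact: diff_derivable.
rewrite deriveD; try by apply: diff_derivable; exact: differentiable_partial.
by congr (_ + _); rewrite mxE.
Qed.

Lemma twice_cont_differentiableD f g :
  twice_cont_differentiable f -> twice_cont_differentiable g ->
  twice_cont_differentiable (fun y => f y + g y).
Proof.
move=> fC2 gC2; have [fd fgd fHc] := fC2; have [gd ggd gHc] := gC2.
split=> [x|x|].
- exact: differentiableD.
- have -> : grad (fun y => f y + g y) = grad f + grad g.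
    by apply/funext => y; rewrite gradD.
  exact: differentiableD.
- have -> : hessian (fun y => f y + g y) = fun y => hessian f y + hessian g y.
    by apply/funext => y; rewrite hessianD.
  by move=> y; apply: continuousD; [exact: fHc|exact: gHc].
Qed.

End Calculus.

(** * Bounded sequences and coercive functions *)

Section SquareBounded.
Context {R : realType}.

(** Boundedness for the Euclidean norm, which is the one controlled by the
    inequalities of the algorithm. *)
Definition sq_bounded {n} (u : nat -> 'cV[R]_n) : Prop :=
  exists K, forall t, dotv (u t) (u t) <= K.

Lemma sq_bounded_shift {n} (u : nat -> 'cV[R]_n) :
  sq_bounded (fun t => u t.+1) -> sq_bounded u.
Proof.
move=> [K uK]; exists (dotv (u 0%N) (u 0%N) + K) => -[|t].
  by rewrite lerDl (le_trans _ (uK 0%N))// dotv_ge0.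
by rewrite (le_trans (uK t))// lerDr dotv_ge0.
Qed.

Lemma sq_boundedZ {n} (a : R) (u : nat -> 'cV[R]_n) :
  sq_bounded u -> sq_bounded (fun t => a *: u t).
Proof.
move=> [K uK]; exists (a ^+ 2 * K) => t.
by rewrite dotvZl dotvZr mulrA -expr2 ler_wpM2l// sqr_ge0.
Qed.

Lemma sq_boundedD {n} (u v : nat -> 'cV[R]_n) :
  sq_bounded u -> sq_bounded v -> sq_bounded (fun t => u t + v t).
Proof.
move=> [K uK] [K' vK]; exists (2 * K + 2 * K') => t.
have := dotv_ge0 (u t - v t); have := uK t; have := vK t.
rewrite !(dotvDl, dotvDr, dotvNl, dotvNr) (dotvC (v t) (u t)); lra.
Qed.

Lemma sq_boundedB {n} (u v : nat -> 'cV[R]_n) :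
  sq_bounded u -> sq_bounded v -> sq_bounded (fun t => u t - v t).
Proof.
move=> ub /(sq_boundedZ (-1)) vb; have := sq_boundedD _ _ ub vb.
by congr sq_bounded; apply/funext => t; rewrite scaleN1r.
Qed.

Lemma sq_bounded_mulmx {m n} (A : 'M[R]_(m, n)) (u : nat -> 'cV[R]_n) :
  sq_bounded u -> sq_bounded (fun t => A *m u t).
Proof.
move=> [K uK]; exists ((\sum_i dotv (row i A)^T (row i A)^T) * K) => t.
rewrite dotvE mulr_suml; apply: ler_sum => i _.
have -> : (A *m u t) i 0 = dotv (row i A)^T (u t).
  by rewrite dotvE mxE; apply: eq_bigr => j _; rewrite !mxE.
rewrite -expr2 (le_trans (cauchy_schwarz _ _))//.
by rewrite ler_wpM2l// dotv_ge0.
Qed.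

(** The bound |a| <= 1 + a^2 avoids a square root when passing from the Euclidean
    norm to the sup norm. *)
Lemma mx_norm_le_dotv {n} (u : 'cV[R]_n) : `|u| <= 1 + dotv u u.
Proof.
rewrite [leLHS]/Num.norm/= mx_normrE; apply/bigmax_leP; split => /=.
  by rewrite addr_ge0// dotv_ge0.
move=> [i j] _ /=; rewrite [j]ord1; have := dotv_sqr_entry u i.
rewrite -real_normK ?num_real//; have := sqr_ge0 (`|u i 0| - 1).
rewrite sqrrB; have := normr_ge0 (u i 0); nra.
Qed.

Lemma bounded_fun_pair3 {n m l} (u : nat -> 'cV[R]_n) (v : nat -> 'cV[R]_m)
    (w : nat -> 'cV[R]_l) :
  sq_bounded u -> sq_bounded v -> sq_bounded w ->
  bounded_fun (fun t => (u t, v t, w t)).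
Proof.
move=> [K1 uK] [K2 vK] [K3 wK].
pose K := 1 + `|K1| + `|K2| + `|K3|.
exists K; split => [|C KC t _ /=]; first exact: num_real.
rewrite (le_trans _ (ltW KC))// /K.
have /= := mx_norm_le_dotv (u t); have /= := mx_norm_le_dotv (v t).
have /= := mx_norm_le_dotv (w t); have := uK t; have := vK t; have := wK t.
have := ler_norm K1; have := ler_norm K2; have := ler_norm K3.
have := normr_ge0 K1; have := normr_ge0 K2; have := normr_ge0 K3.
move=> *; rewrite !ge_max; apply/andP; split; first (apply/andP; split); lra.
Qed.

End SquareBounded.

Section ExtendedReal.
Context {R : realType}.

Lemma sublevel_sq_bounded {n} (f : 'cV[R]_n -> \bar R) (c : R) :
  limf_einf f (@enorm_infty R n) = +oo%E ->
  exists K, forall v, (f v <= c%:E)%E -> dotv v v <= K.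
Proof.
rewrite limf_einfE => sup_oo.
have : (c%:E < ereal_sup [set ereal_inf (f @` V) | V in @enorm_infty R n])%E.
  by rewrite sup_oo ltry.
move=> /ereal_sup_gt[_ [V [r _ rV] <-] c_lt].
exists (r ^+ 2) => v fv_le; rewrite -enorm_sqr.
have [r_lt|v_le] := ltP r (enorm v).
  have : (ereal_inf (f @` V) <= f v)%E.
    by apply: ereal_inf_lbound; exists v => //; exact: rV.
  by move=> /(lt_le_trans c_lt) /lt_le_trans /(_ fv_le); rewrite ltxx.
by rewrite ler_sqr ?nnegrE ?sqrtr_ge0// (le_trans (sqrtr_ge0 _) v_le).
Qed.

Lemma ereal_inf_range_lbound {T : Type} (f : T -> \bar R) :
  (-oo < ereal_inf (range f))%E -> exists c : R, forall v, (c%:E <= f v)%E.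
Proof.
move=> inf_gt.
have inf_le v : (ereal_inf (range f) <= f v)%E.
  by apply: ereal_inf_lbound; exists v.
case: (ereal_inf (range f)) inf_gt inf_le => [c _|_|//] inf_le.
  by exists c.
by exists 0 => v; rewrite (le_trans _ (inf_le v))// leey.
Qed.

End ExtendedReal.

(** * One step of the proximal ADMM *)

Section ProximalStep.
Context {R : realType} {n m : nat}.
Variables (M : 'M[R]_(m, n)) (h phi : 'cV[R]_n -> R) (beta : R).
Implicit Types (x d : 'cV[R]_n) (y z : 'cV[R]_m) (p : R).

(** The augmented Lagrangian with the value [p] of the nonsmooth term as a
    parameter: along the iteration that value is finite, so that comparisons
    take place between real numbers. *)
Definition lagrangian x p y z : R :=
  h x + p - dotv z (M *m x - y) + beta / 2 * dotv (M *m x - y) (M *m x - y).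

Lemma aug_lagrangianE (P : 'cV[R]_m -> \bar R) x p y z : P y = p%:E ->
  aug_lagrangian M h P beta x y z = (lagrangian x p y z)%:E.
Proof. by move=> Py; rewrite /aug_lagrangian Py enorm_sqr. Qed.

(** Exact second-order expansion in [x]. The linear term is written with the
    updated multiplier z - beta (M x - y), so that it combines directly with the
    stationarity condition. *)
Lemma lagrangian_along x d p y z :
  lagrangian (x + d) p y z = lagrangian x p y z + (h (x + d) - h x)
    - dotv (M^T *m (z - beta *: (M *m x - y))) d
    + beta / 2 * dotv (M *m d) (M *m d).
Proof.
rewrite /lagrangian; set r := M *m x - y.
have -> : M *m (x + d) - y = r + M *m d by rewrite mulmxDr addrAC.
rewrite -dotv_mulmx; set q := M *m d.
by clearbody r q; rewrite !(dotvDl, dotvDr, dotvNl, dotvZl) (dotvC q r); field.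
Qed.

(** The optimality condition of the x-update, in which the multiplier update has
    absorbed the gradient of the penalty term. It recovers M^T z from [x], [x'],
    and through it the multiplier is controlled. *)
Definition dual_stationary x x' z : Prop :=
  M^T *m z = grad h x' + grad phi x' - grad phi x.

(** The first-order condition is tested along a single direction, the residual of
    the claimed identity. *)
Lemma proximal_step_stationary x x' y z p :
  (forall u, differentiable h u) -> (forall u, differentiable phi u) ->
  (forall u, lagrangian x' p y z + bregman phi x' x <=
             lagrangian u p y z + bregman phi u x) ->
  dual_stationary x x' (z - beta *: (M *m x' - y)).
Proof.
move=> hdiff phidiff x'_min.
rewrite /dual_stationary; set v := M^T *m _; set w := RHS.
apply/esym/eqP; rewrite -subr_eq0; apply/eqP/dotv_eq0.
have [d dE] : exists d, d = w - v by exists (w - v).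
rewrite -dE.
have fdiff u : differentiable (fun a => h a + phi a) u by exact: differentiableD.
have := stationary_of_min (fun a => h a + phi a) x' d
  (- dotv v d - dotv (grad phi x) d) (beta / 2 * dotv (M *m d) (M *m d)) fdiff.
rewrite gradD// => <-.
  by rewrite {1}dE /w !(dotvDl, dotvNl); ring.
move=> s; have := x'_min (x' + s *: d).
rewrite lagrangian_along /bregman -/v -scalemxAr !(dotvDr, dotvNr, dotvZr, dotvZl).
lra.
Qed.

(** Set d = x - x'. The Lagrangian gains <d, (Q2 + beta M^T M) d> / 2 from the
    expansion at [x'], and stationarity leaves the extra term
    <grad phi x - grad phi x', d>, which is at least <d, T2 d> (strong convexity of
    [phi] used in both directions). Half of that is traded with
    Q2 + beta M^T M + T2 >= delta. *)
Lemma proximal_step_decrease (Q2 T2 : 'M[R]_n) (delta : R) x x' y z p :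
  twice_cont_differentiable h -> twice_cont_differentiable phi ->
  (forall u, loewner_ge (hessian h u) Q2) ->
  (forall u, loewner_ge (hessian phi u) T2) ->
  loewner_ge (Q2 + beta *: (M^T *m M) + T2) delta%:M ->
  dual_stationary x x' (z - beta *: (M *m x' - y)) ->
  lagrangian x' p y z + 2^-1 * dotv (x' - x) ((delta%:M + T2) *m (x' - x))
    <= lagrangian x p y z.
Proof.
move=> hC2 phiC2 hQ2 phiT2 Qdelta stat.
have [d xE] : exists d, x = x' + d by exists (x - x'); rewrite addrC subrK.
have x'E : x' = x + - d by rewrite xE addrK.
have dE : x' - x = - d by rewrite x'E addrAC subrr add0r.
have h_ge := second_order_lower_bound h Q2 x' d hC2 hQ2.
have phi_ge := second_order_lower_bound phi T2 x' d phiC2 phiT2.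
have phi_ge' := second_order_lower_bound phi T2 x (- d) phiC2 phiT2.
have := loewner_ge_dotv _ _ d Qdelta.
rewrite dE.
move: phi_ge'; rewrite -x'E => phi_ge'.
rewrite -xE in h_ge phi_ge.
rewrite [in X in _ -> X]xE lagrangian_along -xE stat.
rewrite !(mulmxDl, mulmxN, dotvNl, dotvNr, dotvDr, dotvDl, opprK) in phi_ge' *.
rewrite -scalemxAl !mul_scalar_mx !dotvZr -mulmxA (dotv_mulmx M^T) trmxK. lra.
Qed.

End ProximalStep.

(** The difference of the two sides is the square of (1 - gamma) a + gamma b,
    divided by gamma (1 - gamma). *)
Lemma young_sub {R : realType} {n} (gamma : R) (a b : 'cV[R]_n) :
  0 < gamma -> gamma < 1 ->
  dotv (a - b) (a - b) <= gamma^-1 * dotv a a + (1 - gamma)^-1 * dotv b b.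
Proof.
move=> g0 g1; have g1' : 0 < 1 - gamma by rewrite subr_gt0.
have := dotv_ge0 ((1 - gamma) *: a + gamma *: b).
move=> sq_ge0; rewrite -subr_ge0.
have -> : gamma^-1 * dotv a a + (1 - gamma)^-1 * dotv b b - dotv (a - b) (a - b)
    = (gamma * (1 - gamma))^-1 *
      dotv ((1 - gamma) *: a + gamma *: b) ((1 - gamma) *: a + gamma *: b).
  rewrite !(dotvDl, dotvDr, dotvNl, dotvNr, dotvZl, dotvZr) (dotvC b a).
  by field; rewrite !gt_eqF.
by rewrite mulr_ge0// invr_ge0 mulr_ge0// ltW.
Qed.

Lemma dotv_trmx_ge {R : realType} {m n} (M : 'M[R]_(m, n)) (sigma : R) (w : 'cV[R]_m) :
  loewner_ge (M *m M^T) sigma%:M ->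
  sigma * dotv w w <= dotv (M^T *m w) (M^T *m w).
Proof.
move=> /(loewner_ge_dotv _ _ w).
by rewrite mul_scalar_mx dotvZr -mulmxA dotv_mulmx.
Qed.

Section Energy.
Context {R : realType} {n m : nat}.
Variables (M : 'M[R]_(m, n)) (h phi : 'cV[R]_n -> R) (T1 : 'M[R]_n).
Variables (beta sigma gamma : R).
Hypotheses (hC2 : twice_cont_differentiable h)
  (phiC2 : twice_cont_differentiable phi).
Hypotheses (beta_gt0 : 0 < beta) (sigma_gt0 : 0 < sigma)
  (gamma_gt0 : 0 < gamma) (gamma_lt1 : gamma < 1).
Hypothesis M_ge : loewner_ge (M *m M^T) sigma%:M.
Hypothesis phi_T1 : forall u,
  loewner_ge (T1 *m T1) (hessian phi u *m hessian phi u).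
Implicit Types (x : 'cV[R]_n) (y z : 'cV[R]_m) (p : R).

(** The Lagrangian itself need not decrease: a multiplier update can increase it,
    by an amount that involves the previous step x1 - x0. Adding a multiple
    of the squared length of the last step makes the total telescope. *)
Definition energy x0 x1 p y z : R := lagrangian M h beta x1 p y z
  + (sigma * beta * (1 - gamma))^-1 * dotv (x1 - x0) (T1 *m T1 *m (x1 - x0)).

Lemma grad_phi_le x0 x1 :
  dotv (grad phi x1 - grad phi x0) (grad phi x1 - grad phi x0)
  <= dotv (x1 - x0) (T1 *m T1 *m (x1 - x0)).
Proof.
by have := grad_lipschitz phi _ x0 (x1 - x0) phiC2 phi_T1; rewrite [x0 + _]addrC subrK.
Qed.

(** The y-update does not increase the Lagrangian, the x-update decreases it by
    <d, (delta + T2) d> / 2 with d = x2 - x1, and the multiplier update increases it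
    by |z2 - z1|^2 / beta. Since M M^T >= sigma, the latter is at most
    |M^T (z2 - z1)|^2 / (sigma beta). By stationarity M^T (z2 - z1) is a difference
    of gradients of h + phi at x2, x1 minus one of phi at x1, x0; Young's
    inequality splits it into a part bounded by Q3 on the current step and a part
    bounded by T1^2 on the previous one, which the energy has in store. The
    condition on beta says that the decrease pays for both. *)
Lemma energy_step (T2 Q3 : 'M[R]_n) (delta : R) x0 x1 x2 p1 p2 y1 y2 z1 z2 :
  (forall u, loewner_ge Q3
    ((hessian h u + hessian phi u) *m (hessian h u + hessian phi u))) ->
  loewner_gt (delta%:M + T2)
    ((2 / (sigma * beta)) *:
      (gamma^-1 *: Q3 + (1 - gamma)^-1 *: (T1 *m T1))) ->
  dual_stationary M h phi x0 x1 z1 -> dual_stationary M h phi x1 x2 z2 ->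
  z2 = z1 - beta *: (M *m x2 - y2) ->
  lagrangian M h beta x1 p2 y2 z1 <= lagrangian M h beta x1 p1 y1 z1 ->
  lagrangian M h beta x2 p2 y2 z1
      + 2^-1 * dotv (x2 - x1) ((delta%:M + T2) *m (x2 - x1))
    <= lagrangian M h beta x1 p2 y2 z1 ->
  energy x1 x2 p2 y2 z2 <= energy x0 x1 p1 y1 z1.
Proof.
move=> Q3_ge delta_gt stat1 stat2 z2E y_le x_le.
have g1 : 0 < 1 - gamma by rewrite subr_gt0.
have grad_le : dotv (grad h x2 + grad phi x2 - (grad h x1 + grad phi x1))
    (grad h x2 + grad phi x2 - (grad h x1 + grad phi x1)) <=
    dotv (x2 - x1) (Q3 *m (x2 - x1)).
  have := grad_lipschitz (fun u => h u + phi u) Q3 x1 (x2 - x1)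
    (twice_cont_differentiableD _ _ hC2 phiC2).
  have [hd _ _] := hC2; have [phid _ _] := phiC2.
  rewrite [x1 + _]addrC subrK !gradD//; apply => u.
  by rewrite hessianD.
have phi_le := grad_phi_le x0 x1.
have Mz_le := dotv_trmx_ge M sigma (z2 - z1) M_ge.
have MzE : M^T *m (z2 - z1) =
    (grad h x2 + grad phi x2 - (grad h x1 + grad phi x1)) - (grad phi x1 - grad phi x0).
  rewrite mulmxBr stat1 stat2.
  move: (grad h x2) (grad phi x2) (grad h x1) (grad phi x1) (grad phi x0).
  move=> a b c d e.
  by apply/colP => i; rewrite !mxE; ring.
rewrite MzE in Mz_le.
have := young_sub gamma (grad h x2 + grad phi x2 - (grad h x1 + grad phi x1))
  (grad phi x1 - grad phi x0) gamma_gt0 gamma_lt1.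
move: Mz_le grad_le phi_le {MzE}.
set N := dotv (z2 - z1) _; set A := dotv _ (Q3 *m _).
set B1 := dotv (x1 - x0) _; set ga := dotv (_ - _) (_ - _).
set gab := dotv (_ - _) (_ - _); set gb := dotv (_ - _) (_ - _).
move=> N_le ga_le gb_le gab_le.
have delta_ge : 2 * (sigma * beta)^-1 *
    (gamma^-1 * A + (1 - gamma)^-1 * dotv (x2 - x1) (T1 *m T1 *m (x2 - x1))) <=
    dotv (x2 - x1) ((delta%:M + T2) *m (x2 - x1)).
  have [d0|d0] := eqVneq (x2 - x1) 0.
    by rewrite /A d0 !mulmx0 !dotv0 !mulr0 addr0 mulr0.
  have := delta_gt _ d0; rewrite mulmxBl dotvBr subr_gt0 => /ltW; apply: le_trans.
  by rewrite -!scalemxAl mulmxDl -!scalemxAl !(dotvZr, dotvDr).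
have LE : lagrangian M h beta x2 p2 y2 z2 =
    lagrangian M h beta x2 p2 y2 z1 + beta^-1 * N.
  rewrite /N /lagrangian z2E; move: (M *m x2 - y2) => r.
  rewrite [_ - z1]addrAC subrr add0r !(dotvDl, dotvNl, dotvNr, dotvZl, dotvZr).
  by field; rewrite gt_eqF.
have N_le' : beta^-1 * N <= (sigma * beta)^-1 * (gamma^-1 * A + (1 - gamma)^-1 * B1).
  have -> : beta^-1 * N = (sigma * beta)^-1 * (sigma * N).
    by field; rewrite !gt_eqF.
  rewrite ler_pM2l ?invr_gt0 ?mulr_gt0// (le_trans N_le)// (le_trans gab_le)//.
  by rewrite lerD// ler_pM2l// invr_gt0.
rewrite /energy LE -/B1 !invfM; rewrite !invfM in delta_ge N_le'; lra.
Qed.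

(** By stationarity M^T z is grad h at the new point plus a difference of
    gradients of [phi]. *)
Lemma multiplier_le x0 x1 z : dual_stationary M h phi x0 x1 z ->
  sigma * dotv z z <= gamma^-1 * dotv (grad h x1) (grad h x1)
    + (1 - gamma)^-1 * dotv (x1 - x0) (T1 *m T1 *m (x1 - x0)).
Proof.
move=> stat; apply: (le_trans (dotv_trmx_ge M sigma z M_ge)).
have g1 : 0 < 1 - gamma by rewrite subr_gt0.
have := young_sub gamma (grad h x1) (grad phi x0 - grad phi x1) gamma_gt0 gamma_lt1.
have -> : grad h x1 - (grad phi x0 - grad phi x1) = M^T *m z.
  by rewrite stat opprB addrA.
move=> /le_trans; apply; rewrite lerD2l ler_pM2l ?invr_gt0//.
by rewrite -[grad phi x0 - _]opprB dotvNl dotvNr opprK grad_phi_le.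
Qed.


(** Completing the square in M x1 - y leaves -|z|^2 / (2 beta), which
    [multiplier_le] bounds. The step term of the energy is halved in the process but
    survives. *)
Lemma energy_ge x0 x1 p y z : dual_stationary M h phi x0 x1 z ->
  h x1 + p - (2 * beta * sigma * gamma)^-1 * dotv (grad h x1) (grad h x1)
    + (2 * (sigma * beta * (1 - gamma)))^-1
      * dotv (x1 - x0) (T1 *m T1 *m (x1 - x0))
  <= energy x0 x1 p y z.
Proof.
move=> stat; rewrite /energy /lagrangian; set r := M *m x1 - y; set tau := dotv (x1 - x0) _.
have := multiplier_le _ _ _ stat; rewrite -/tau => z_le.
have zE : (2 * beta)^-1 * dotv z z <= (2 * beta * sigma)^-1 *
    (gamma^-1 * dotv (grad h x1) (grad h x1) + (1 - gamma)^-1 * tau).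
  have -> : (2 * beta)^-1 * dotv z z = (2 * beta * sigma)^-1 * (sigma * dotv z z).
    by field; rewrite !gt_eqF.
  by rewrite ler_pM2l// invr_gt0 !mulr_gt0.
have sq_ge0 : 0 <= beta / 2 * dotv (r - beta^-1 *: z) (r - beta^-1 *: z).
  by rewrite !mulr_ge0 ?dotv_ge0// ltW.
have sqE : beta / 2 * dotv (r - beta^-1 *: z) (r - beta^-1 *: z) =
    beta / 2 * dotv r r - dotv z r + (2 * beta)^-1 * dotv z z.
  clearbody r; rewrite !(dotvDl, dotvDr, dotvNl, dotvNr, dotvZl, dotvZr) (dotvC r z).
  by field; rewrite gt_eqF.
rewrite sqE in sq_ge0; rewrite !invfM in zE sq_ge0 *; lra.
Qed.

End Energy.

(** * Boundedness of the iterates *)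

(** A function whose proximal problem at the origin is solvable lies above a
    concave quadratic; in particular it is bounded below on bounded sets. *)
Lemma prox_quadratic_minorant {R : realType} {m : nat} (P : 'cV[R]_m -> \bar R) :
  proper_function P ->
  argmin (fun y => (1%:E * P y + (2^-1 * enorm (y - 0) ^+ 2)%:E)%E) !=set0 ->
  exists c : R, forall y, (c%:E <= P y + (2^-1 * dotv y y)%:E)%E.
Proof.
move=> [[v0 v0_lt] P_gt] [w w_min].
have w_le y : (P w + (2^-1 * dotv w w)%:E <= P y + (2^-1 * dotv y y)%:E)%E.
  by have := w_min y; rewrite !mul1e !subr0 !enorm_sqr.
case Pw : (P w) (P_gt w) => [c| |]// _.
  by exists (c + 2^-1 * dotv w w) => y; have := w_le y; rewrite Pw.
have := w_le v0; rewrite Pw; case: (P v0) v0_lt (P_gt v0) => [c| |]//.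
Qed.

(** The inverse function is not known to be linear, nor the matrix to be square;
    the columns of the matrix inverse are the preimages of the basis vectors. *)
Lemma bijective_mulmx_linv {R : realType} {m n : nat} (M : 'M[R]_(m, n)) :
  bijective (fun x : 'cV[R]_n => M *m x) -> exists N, forall x : 'cV[R]_n, N *m (M *m x) = x.
Proof.
move=> [g Mg gM].
pose N := \matrix_(i, j) g (delta_mx j 0) i 0.
have MN : M *m N = 1%:M.
  apply/matrixP => i j; rewrite -[M *m N]/(M *m N).
  have <- : (M *m g (delta_mx j 0)) i 0 = (M *m N) i j.
    by rewrite !mxE; apply: eq_bigr => k _; rewrite mxE.
  by rewrite gM !mxE eqxx andbT.
exists N => x; apply: (can_inj Mg).
by rewrite !mulmxA MN mul1mx.
Qed.

Theorem theorem2 (R : realType) (n m : nat) (M : 'M[R]_(m, n))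
  (h : 'cV[R]_n -> R) (P : 'cV[R]_m -> \bar R)
  (h_C2 : twice_cont_differentiable h)
  (h_bounded_hessian : bounded_fun (hessian h))
  (P_proper : proper_function P)
  (P_closed : lower_semicontinuous P)
  (P_prox : forall (u : 'cV[R]_m) (tau : R), 0 < tau ->
    argmin (fun y => (tau%:E * P y + (2^-1 * enorm (y - u) ^+ 2)%:E)%E)
      !=set0)
  (beta : R) (beta_gt0 : 0 < beta)
  (phi : 'cV[R]_n -> R)
  (phi_C2 : twice_cont_differentiable phi)
  (phi_convex : convex_function setT phi)
  (* Assumption A (i) *)
  (sigma : R) (sigma_gt0 : 0 < sigma)
  (A_i_M : loewner_ge (M *m M^T) sigma%:M)
  (Q1 Q2 : 'M[R]_n) (Q1_sym : Q1^T = Q1) (Q2_sym : Q2^T = Q2)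
  (A_i_h : forall x, loewner_ge Q1 (hessian h x) /\
                     loewner_ge (hessian h x) Q2)
  (* Assumption A (ii) (a) *)
  (T1 T2 : 'M[R]_n) (T1_sym : T1^T = T1) (T2_sym : T2^T = T2)
  (T12 : loewner_ge T1 T2) (T2_ge0 : loewner_ge T2 0)
  (A_ii_a : forall x,
    loewner_ge (T1 *m T1) (hessian phi x *m hessian phi x) /\
    loewner_ge (hessian phi x *m hessian phi x) (T2 *m T2))
  (* Assumption A (ii) (b) *)
  (delta : R) (delta_gt0 : 0 < delta)
  (A_ii_b : loewner_ge (Q2 + beta *: (M^T *m M) + T2) delta%:M)
  (* Assumption A (ii) (c) *)
  (Q3 : 'M[R]_n) (Q3_sym : Q3^T = Q3)
  (Q3_ge : forall x, loewner_ge Q3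
    ((hessian h x + hessian phi x) *m (hessian h x + hessian phi x)))
  (gamma : R) (gamma_gt0 : 0 < gamma) (gamma_lt1 : gamma < 1)
  (A_ii_c : loewner_gt (delta%:M + T2)
    ((2 / (sigma * beta)) *:
      (gamma^-1 *: Q3 + (1 - gamma)^-1 *: (T1 *m T1))))
  (beta_choice : exists zeta : R,
    [/\ 0 < zeta, zeta < 2 * beta * gamma
      & (-oo < ereal_inf (range (fun x : 'cV[R]_n =>
           (h x - (sigma * zeta)^-1 * enorm (grad h x) ^+ 2)%:E)))%E])
  (alternative :
    (bijective (fun x : 'cV[R]_n => M *m x) /\
     limf_einf P (@enorm_infty R m) = +oo%E)
    \/
    (limf_einf (fun x => (h x)%:E) (@enorm_infty R n) = +oo%E /\
     (-oo < ereal_inf (range P))%E))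
  (x0 : 'cV[R]_n) (z0 : 'cV[R]_m)
  (x : nat -> 'cV[R]_n) (y z : nat -> 'cV[R]_m)
  (xyz_ADMM : proximal_ADMM M h P beta phi x0 z0 x y z) :
  bounded_fun (fun t : nat => (x t, y t, z t)).
Proof.
have [[v0 v0_lt] P_gt] := P_proper.
have [hdiff _ _] := h_C2; have [phidiff _ _] := phi_C2.
have [x0E z0E step] := xyz_ADMM.
have g1 : 0 < 1 - gamma by rewrite subr_gt0.
have phi_T1 u := (A_ii_a u).1.
have phi_T2 u : loewner_ge (hessian phi u) T2.
  apply: loewner_ge_sqr; rewrite ?hessian_sym//; first exact: convex_hessian_psd.
    by have := T2_ge0; rewrite /loewner_ge subr0.
  by have [] := A_ii_a u.
have h_Q2 u := (A_i_h u).2.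
(* Every iterate y lies in the domain of P, since it does as well as v0. *)
have Py_fin t : exists p, P (y t.+1) = p%:E.
  have [y_min _ _] := step t; have := y_min v0; rewrite /aug_lagrangian.
  case: (P (y t.+1)) (P_gt (y t.+1)) => [p| |]//; first by exists p.
  by case: (P v0) v0_lt (P_gt v0).
have [p pE] := choice Py_fin.
have zE t : z t - beta *: (M *m x t.+1 - y t.+1) = z t.+1.
  by have [_ _ ->] := step t.
have stat t : dual_stationary M h phi (x t) (x t.+1) (z t.+1).
  rewrite -zE; apply: (proximal_step_stationary _ _ _ _ _ _ _ _ (p t)) => // u.
  have [_ x_min _] := step t; have := x_min u.
  by rewrite !(aug_lagrangianE _ _ _ _ _ (p t))//= lee_fin.
have energy_le t : energy M h T1 beta sigma gamma (x t) (x t.+1) (p t) (y t.+1) (z t.+1)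
    <= energy M h T1 beta sigma gamma (x 0%N) (x 1%N) (p 0%N) (y 1%N) (z 1%N).
  elim: t => // t; apply: le_trans.
  apply: (energy_step M h phi T1 beta sigma gamma h_C2 phi_C2 beta_gt0 sigma_gt0
    gamma_gt0 gamma_lt1 A_i_M phi_T1 T2 Q3 delta _ _ _ _ _ _ _ _ _ Q3_ge A_ii_c
    (stat t) (stat t.+1)); first by rewrite zE.
  - have [y_min _ _] := step t.+1; have := y_min (y t.+1).
    by rewrite (aug_lagrangianE _ _ _ _ _ (p t.+1))// (aug_lagrangianE _ _ _ _ _ (p t)).
  - apply: (proximal_step_decrease M h phi beta Q2) => //.
    by rewrite zE.
have [zeta [zeta_gt0 zeta_lt /ereal_inf_range_lbound[h0 h0_le]]] := beta_choice.
set C := energy _ _ _ _ _ _ _ _ _ _ _ in energy_le.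
pose G t := dotv (grad h (x t.+1)) (grad h (x t.+1)).
pose tau t := dotv (x t.+1 - x t) (T1 *m T1 *m (x t.+1 - x t)).
have tau_ge0 t : 0 <= tau t by rewrite /tau -mulmxA dotv_mulmx T1_sym dotv_ge0.
have G_ge0 t : 0 <= G t by exact: dotv_ge0.
have G_le t : G t <= sigma * zeta * (h (x t.+1) - h0).
  have := h0_le (x t.+1); rewrite lee_fin enorm_sqr -/(G t) => ?.
  rewrite -ler_pdivrMl ?mulr_gt0//; lra.
(* kappa is the fraction of h consumed by the squared gradient of h in the lower
   bound of the energy; zeta < 2 beta gamma leaves some of h over. *)
pose kappa := zeta / (2 * beta * gamma).
have kappa_lt1 : kappa < 1 by rewrite ltr_pdivrMr ?mulr_gt0// mul1r.
have kappa_gt0 : 0 < kappa by rewrite divr_gt0 ?mulr_gt0.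
have h_ge t : h0 <= h (x t.+1).
  rewrite -subr_ge0 -(pmulr_rge0 _ (mulr_gt0 sigma_gt0 zeta_gt0)).
  exact: le_trans (G_ge0 t) (G_le t).
pose k := (2 * (sigma * beta * (1 - gamma)))^-1.
have k_gt0 : 0 < k by rewrite invr_gt0 !mulr_gt0.
have main_le t : (1 - kappa) * (h (x t.+1) - h0) + h0 + p t + k * tau t <= C.
  apply: le_trans (energy_le t).
  apply: le_trans (energy_ge _ _ _ _ _ _ _ phi_C2 beta_gt0 sigma_gt0 gamma_gt0 gamma_lt1
    A_i_M phi_T1 _ _ _ _ _ (stat t)).
  rewrite -/(G t) -/(tau t) -/k lerD2r.
  have : (2 * beta * sigma * gamma)^-1 * G t <= kappa * (h (x t.+1) - h0).
    have -> : kappa * (h (x t.+1) - h0) =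
        (2 * beta * sigma * gamma)^-1 * (sigma * zeta * (h (x t.+1) - h0)).
      by rewrite /kappa; field; rewrite !gt_eqF.
    by rewrite ler_pM2l// invr_gt0 !mulr_gt0.
  lra.
(* In both alternatives it now suffices to bound P below along the iterates. *)
have hz_bounded p0 : (forall t, p0 <= p t) ->
    (exists K, forall t, h (x t.+1) <= K) /\ sq_bounded z.
  move=> p_ge.
  have h_le t : h (x t.+1) <= h0 + (C - h0 - p0) / (1 - kappa).
    rewrite -lerBlDl ler_pdivlMr ?subr_gt0//.
    have := main_le t; have := p_ge t; have := mulr_ge0 (ltW k_gt0) (tau_ge0 t).
    lra.
  have tau_le t : tau t <= (C - h0 - p0) / k.
    rewrite ler_pdivlMr//.
    have := main_le t; have := p_ge t.
    have : 0 <= (1 - kappa) * (h (x t.+1) - h0).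
      by rewrite mulr_ge0 ?subr_ge0// ltW.
    lra.
  split; first by exists (h0 + (C - h0 - p0) / (1 - kappa)).
  apply: sq_bounded_shift; exists (sigma^-1 * (gamma^-1 *
    (sigma * zeta * ((C - h0 - p0) / (1 - kappa))) +
    (1 - gamma)^-1 * ((C - h0 - p0) / k))) => t.
  rewrite -ler_pdivrMl ?invr_gt0// invrK.
  apply: le_trans (multiplier_le _ h _ _ _ _ phi_C2 gamma_gt0 gamma_lt1 A_i_M phi_T1 _ _ _ (stat t)) _.
  rewrite lerD// ler_pM2l ?invr_gt0//; last exact: tau_le.
  apply: le_trans (G_le t) _.
  by rewrite ler_pM2l ?mulr_gt0// lerBlDl.
(* The multiplier update, solved for y: once z is bounded, so is y - M x. *)
have yE t : y t.+1 = M *m x t.+1 + beta^-1 *: (z t.+1 - z t).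
  rewrite -zE [_ - z t]addrAC subrr add0r scalerN scalerA mulVf ?gt_eqF//.
  by rewrite scale1r opprB addrC subrK.
have zdiff : sq_bounded z -> sq_bounded (fun t => beta^-1 *: (z t.+1 - z t)).
  move=> zb; apply: sq_boundedZ; apply: sq_boundedB => //.
  by case: zb => K zK; exists K.
case: alternative => [[M_bij P_coercive]|[h_coercive P_bounded]].
- have p_le t : p t <= C - h0.
    have := main_le t; have := mulr_ge0 (ltW k_gt0) (tau_ge0 t).
    have : 0 <= (1 - kappa) * (h (x t.+1) - h0).
      by rewrite mulr_ge0 ?subr_ge0// ltW.
    lra.
  have [Ky Py_le] := sublevel_sq_bounded P (C - h0) P_coercive.
  have y_le t : dotv (y t.+1) (y t.+1) <= Ky by apply: Py_le; rewrite pE lee_fin.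
  have [c c_le] := prox_quadratic_minorant P P_proper (P_prox 0 1 ltr01).
  (* On the bounded sequence y, the quadratic minorant is a constant one. *)
  have [t|_ zb] := hz_bounded (c - 2^-1 * Ky).
    have := c_le (y t.+1); rewrite pE lee_fin; have := y_le t; lra.
  have yb : sq_bounded (fun t => y t.+1) by exists Ky.
  have [N NM] := bijective_mulmx_linv M M_bij.
  apply: bounded_fun_pair3 => //; last exact: sq_bounded_shift.
  apply: sq_bounded_shift.
  have := sq_bounded_mulmx N _ (sq_boundedB _ _ yb (zdiff zb)).
  by congr sq_bounded; apply/funext => t; rewrite yE addrK NM.
- have [p0 p0_le] := ereal_inf_range_lbound _ P_bounded.
  have [t|[K h_le] zb] := hz_bounded p0.
    by have := p0_le (y t.+1); rewrite pE lee_fin.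
  have [Kx hx_le] := sublevel_sq_bounded _ K h_coercive.
  have xb : sq_bounded (fun t => x t.+1).
    by exists Kx => t; apply: hx_le; rewrite lee_fin.
  apply: bounded_fun_pair3 => //; first exact: sq_bounded_shift.
  apply: sq_bounded_shift.
  have := sq_boundedD _ _ (sq_bounded_mulmx M _ xb) (zdiff zb).
  by congr sq_bounded; apply/funext => t; rewrite yE.
Qed.
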